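(* Let $p$ be an odd prime and let $G$ be any nontrivial group of nilpotency class at most $2$ and exponent $p$. Then there exists a non-capable group $G_2\in\mathcal{R}_p$ that contains $G$ (that is, $G_2$ has a subgroup isomorphic to $G$). If $G$ is nonabelian, then $G_2$ may be chosen so that $\operatorname{rank}(G_2^{\rm ab})\leq \operatorname{rank}(G^{\rm ab})+6$. If $G$ is abelian, then $G_2$ may be chosen so that $\operatorname{rank}(G_2^{\rm ab})\leq \operatorname{rank}(G^{\rm ab})+7$.
   Context: A group $G$ is called capable if it is a central factor group, i.e. $G\cong K/Z(K)$ for some group $K$. $G^{\rm ab}=G/[G,G]$ denotes the abelianization; for a group of prime exponent $p$ it is an $\mathbb{F}_p$-vector space, and its rank is its minimal number of generators, i.e. its dimension over $\mathbb{F}_p$. A group $G$ is a central product of subgroups $C$ and $D$ if $G=CD$ and $[C,D]=\{e\}$ (direct products are a special case). The central product is called trivial if $C\subseteq D$ or $D\subseteq C$, and nontrivial otherwise. For an odd prime $p$, $\mathcal{R}_p$ denotes the class of all $p$-groups $G$ of exponent $p$ such that: (i) $G$ cannot be decomposed as a nontrivial central product; (ii) $Z(G)=[G,G]$; and (iii) whenever $\{x_1,\ldots,x_n\}\subseteq G$ is a transversal for $G/Z(G)$, there is a nontrivial relation among the nontrivial commutators of the form $[x_j,x_i]$, $1\leq i<j\leq n$. Here ''transversal for $G/Z(G)$'' means that $x_1,\ldots,x_n$ project to a basis of the $\mathbb{F}_p$-vector space $G/Z(G)$ (so every element of $G$ is uniquely $x_1^{r_1}\cdots x_n^{r_n}z$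 with $0\leq r_i<p$ and $z\in Z(G)$), and ''nontrivial relation'' means that the family of those commutators $[x_j,x_i]$, indexed by the pairs $i<j$ with $[x_j,x_i]\neq e$, is linearly dependent over $\mathbb{F}_p$ in $[G,G]$ (coincidences between commutators with different indices count as relations). *)

(* Defs.v *)
From HB Require Import structures.
From mathcomp Require Import all_boot.
From mathcomp Require Import boolp classical_sets functions cardinality.

Set Implicit Arguments.
Unset Strict Implicit.
Unset Printing Implicit Defensive.

Local Open Scope classical_set_scope.
Local Open Scope card_scope.
Local Open Scope quotient_scope.
Local Open Scope group_scope.

(* Groups are MathComp's [groupType]s, finite or infinite, and subsets are
   classical sets.  A [groupType] carries a choice structure; with the axioms
   of [boolp] every group has one, so this is no restriction. *)

Definition nontrivial (G : groupType) : Prop := exists x : G, x <> 1.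

Definition abelian (G : groupType) : Prop := forall x y : G, commute x y.

Definition is_subgroup (G : groupType) (H : set G) : Prop :=
  H 1 /\ forall x y, H x -> H y -> H (x / y).

Definition generated (G : groupType) (A : set G) : set G :=
  smallest (@is_subgroup G) A.

Definition generates (G : groupType) (A : set G) : Prop :=
  generated A = [set: G].

Definition center (G : groupType) : set G :=
  [set z | forall x : G, commute z x].
Arguments center : clear implicits.

Definition comm_subgroup (G : groupType) (A B : set G) : set G :=
  generated [set [~ a, b] | a in A & b in B].

Definition derived (G : groupType) : set G :=
  comm_subgroup [set: G] [set: G].
Arguments derived : clear implicits.

Definition nil_class_le2 (G : groupType) : Prop :=
  comm_subgroup (derived G) [set: G] = [set 1].

(* The exponent is the least positive [e] that kills every element. *)
Definition has_exponent (G : groupType) (e : nat) : Prop :=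
  [/\ (0 < e)%N, (forall x : G, x ^+ e = 1)
    & forall m, (0 < m)%N -> (forall x : G, x ^+ m = 1) -> (e <= m)%N].

Definition is_pgroup (p : nat) (G : groupType) : Prop :=
  forall x : G, exists k : nat, x ^+ (p ^ k) = 1.

Definition isomorphic (G H : groupType) : Prop :=
  exists f : {multiplicative G -> H}, bijective f.

Definition contains (G2 G : groupType) : Prop :=
  exists (H : set G2) (f : {multiplicative G -> G2}),
    is_subgroup H /\ set_bij [set: G] H f.

Record normal_subgroup (G : groupType) := NormalSubgroup {
  ns_set : set G;
  ns_subgroup : is_subgroup ns_set;
  ns_conj : forall x y, ns_set x -> ns_set (x ^ y)
}.

Section SubgroupFacts.
Variable G : groupType.
Implicit Types (H A : set G) (x y : G).

Lemma subgroupV H x : is_subgroup H -> H x -> H x^-1.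
Proof. by move=> [H1 Hd] Hx; rewrite -[x^-1]mul1g; exact: Hd. Qed.

Lemma subgroupM H x y : is_subgroup H -> H x -> H y -> H (x * y).
Proof.
move=> sH Hx Hy; rewrite -[y]invgK; apply: sH.2 => //; exact: subgroupV.
Qed.

Lemma generated_subgroup A : is_subgroup (generated A).
Proof.
split; first by move=> H [[]].
move=> x y Hx Hy H HA; exact: HA.1.2 (Hx H HA) (Hy H HA).
Qed.

Lemma sub_generated A : A `<=` generated A.
Proof. by move=> x Ax H [_]; apply. Qed.

Lemma center_subgroup : is_subgroup (center G).
Proof.
split=> [x|x y Zx Zy z]; first by rewrite /commute mul1g mulg1.
have Vz : y^-1 * z = z * y^-1.
  by apply: (mulgI y); rewrite mulgA mulgV mul1g mulgA Zy -mulgA mulgV mulg1.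
by rewrite /commute -mulgA Vz mulgA (Zx z) -mulgA.
Qed.

Lemma center_conj x y : center G x -> center G (x ^ y).
Proof. by move=> Zx; rewrite /conjg Zx mulgA mulVg mul1g. Qed.

Lemma derived_conj x y : derived G x -> derived G (x ^ y).
Proof.
move=> Dx; have -> : x ^ y = x * [~ x, y].
  by rewrite /commg mulgA mulgV mul1g.
apply: (subgroupM (generated_subgroup _)) => //.
by apply: sub_generated; exists x => //; exists y.
Qed.

End SubgroupFacts.

Definition center_ns (G : groupType) : normal_subgroup G :=
  NormalSubgroup (@center_subgroup G) (@center_conj G).

Definition derived_ns (G : groupType) : normal_subgroup G :=
  NormalSubgroup (generated_subgroup _) (@derived_conj G).

(* [quot N] is the group of cosets of [N], with [x] and [y] identified when
   [x^-1 * y] lies in [N]. *)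
Section Quotient.
Variables (G : groupType) (N : normal_subgroup G).

Definition coset_eq (x y : G) : bool := `[< ns_set N (x^-1 * y) >].

Lemma coset_eq_refl : reflexive coset_eq.
Proof. by move=> x; apply/asboolP; rewrite mulVg; exact: (ns_subgroup N).1. Qed.

Lemma coset_eq_sym : symmetric coset_eq.
Proof.
suff h x y : coset_eq x y -> coset_eq y x by move=> x y; apply/idP/idP; exact: h.
move=> /asboolP /(subgroupV (ns_subgroup N)) Nxy; apply/asboolP.
by rewrite invgM invgK in Nxy.
Qed.

Lemma coset_eq_trans : transitive coset_eq.
Proof.
move=> y x z /asboolP Nxy /asboolP Nyz; apply/asboolP.
have -> : x^-1 * z = (x^-1 * y) * (y^-1 * z) by rewrite mulgA mulgK.
exact: (subgroupM (ns_subgroup N)).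
Qed.

Canonical coset_equiv :=
  EquivRel coset_eq coset_eq_refl coset_eq_sym coset_eq_trans.

Definition quot : Type := {eq_quot coset_eq}.

HB.instance Definition _ := Choice.on quot.
HB.instance Definition _ := EqQuotient.on quot.

Lemma pi_quotP (x y : G) :
  reflect (ns_set N (x^-1 * y)) (\pi_quot x == \pi_quot y).
Proof. by rewrite piE; exact: asboolP. Qed.

Definition quot_one : quot := \pi_quot 1.
Definition quot_inv (u : quot) : quot := \pi_quot (repr u)^-1.
Definition quot_mul (u v : quot) : quot := \pi_quot (repr u * repr v).

Lemma repr_piP (x : G) : ns_set N (x^-1 * repr (\pi_quot x)).
Proof. by apply/pi_quotP; rewrite reprK. Qed.

Lemma quot_invE x : quot_inv (\pi_quot x) = \pi_quot x^-1.
Proof.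
apply/eqP; rewrite eq_sym; apply/pi_quotP; rewrite invgK.
have Nx := subgroupV (ns_subgroup N) (repr_piP x).
have := ns_conj x^-1 Nx.
by rewrite /conjg !invgM !invgK -mulgA mulgV mulg1.
Qed.

Lemma quot_mulE x y : quot_mul (\pi_quot x) (\pi_quot y) = \pi_quot (x * y).
Proof.
apply/eqP; rewrite eq_sym; apply/pi_quotP.
have -> : (x * y)^-1 * (repr (\pi_quot x) * repr (\pi_quot y)) =
  (x^-1 * repr (\pi_quot x)) ^ y * (y^-1 * repr (\pi_quot y)).
  by rewrite /conjg invgM !mulgA mulgK.
apply: (subgroupM (ns_subgroup N)); last exact: repr_piP.
exact/ns_conj/repr_piP.
Qed.

Lemma quot_surj (u : quot) : exists x, u = \pi_quot x.
Proof. by exists (repr u); rewrite reprK. Qed.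

Lemma quot_mulA : associative quot_mul.
Proof.
move=> u v w.
have [x ->] := quot_surj u; have [y ->] := quot_surj v.
have [z ->] := quot_surj w.
by rewrite (quot_mulE y z) (quot_mulE x y) (quot_mulE x) quot_mulE mulgA.
Qed.

Lemma quot_mul1 : left_id quot_one quot_mul.
Proof. by move=> u; have [x ->] := quot_surj u; rewrite quot_mulE mul1g. Qed.

Lemma quot_mulr1 : right_id quot_one quot_mul.
Proof. by move=> u; have [x ->] := quot_surj u; rewrite quot_mulE mulg1. Qed.

Lemma quot_mulV : left_inverse quot_one quot_inv quot_mul.
Proof.
move=> u; have [x ->] := quot_surj u.
by rewrite (quot_invE x) quot_mulE mulVg.
Qed.

Lemma quot_mulrV : right_inverse quot_one quot_inv quot_mul.
Proof.
move=> u; have [x ->] := quot_surj u.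
by rewrite (quot_invE x) quot_mulE mulgV.
Qed.

HB.instance Definition _ := isGroup.Build quot
  quot_mulA quot_mul1 quot_mulr1 quot_mulV quot_mulrV.

End Quotient.

Definition abelianization (G : groupType) : groupType := quot (derived_ns G).

Definition capable (G : groupType) : Prop :=
  exists K : groupType, isomorphic G (quot (center_ns K)).

(* rank(A) <= rank(B) + k as cardinals, where the rank is the least cardinality
   of a generating set: every generating set Y of B leaves room, after adding k
   points, for some generating set X of A.  When B is finitely generated this
   is the inequality between natural numbers. *)
Definition rank_leD (A B : groupType) (k : nat) : Prop :=
  forall Y : set B, generates Y ->
  exists X : set A, generates X /\
    X #<= ([set inl y | y in Y] `|` [set inr i | i in [set: 'I_k]] :
             set (B + 'I_k)%type).

Definition central_product (G : groupType) (C D : set G) : Prop :=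
  [/\ is_subgroup C, is_subgroup D,
      [set c * d | c in C & d in D] = [set: G]
    & comm_subgroup C D = [set 1]].

(* x_0, ..., x_(n-1) project to an F_p-basis of G/Z(G). *)
Definition center_transversal (p : nat) (G : groupType) (n : nat)
    (x : 'I_n -> G) : Prop :=
  forall g : G, exists! r : {ffun 'I_n -> 'I_p},
    exists2 z, center G z & g = (\prod_(i < n) x i ^+ r i) * z.

(* The pair (i, j) stands for the commutator [x_j, x_i]; only the pairs with
   i < j and [x_j, x_i] <> 1 occur, with coefficient r (i, j) in F_p. *)
Definition comm_index (G : groupType) (n : nat) (x : 'I_n -> G)
    (ij : 'I_n * 'I_n) : bool :=
  (ij.1 < ij.2)%N && ([~ x ij.2, x ij.1] != 1).

Definition comm_relation (p : nat) (G : groupType) (n : nat) (x : 'I_n -> G) :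
    Prop :=
  exists r : 'I_n * 'I_n -> 'I_p,
    \prod_(ij | comm_index x ij) [~ x ij.2, x ij.1] ^+ r ij = 1 /\
    exists2 ij, comm_index x ij & (r ij != 0 :> nat)%N.

Definition class_R (p : nat) (G : groupType) : Prop :=
  [/\ is_pgroup p G /\ has_exponent G p,
      forall C D : set G, central_product C D -> C `<=` D \/ D `<=` C,
      center G = derived G
    & forall (n : nat) (x : 'I_n -> G),
        center_transversal p x -> comm_relation p x].

(* Main.v *)
(** Add six generators a, ..., f and, as new central elements, a copy of G^ab and
    F_p^6, so that the only nontrivial commutators among and with the new
    generators are [a,b] = [c,d] = z, the independent [e,a], [e,b], [f,c], [f,d],
    [e,f], and [e,g] = the class of g in G^ab for g in G.

    Every element is a product of one commuting with a and b and one commuting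
    with c and d. If the group is K/Z(K), conjugation by a lift of the former
    moves lifts of a and b by central factors, hence fixes a lift of z = [a,b];
    likewise for the latter with z = [c,d]. So z lifts into Z(K), although z is
    nontrivial.

    If the commutators of a transversal were independent, then reading off the
    coefficient of one of them would send the commutator map to a form of rank 2
    that is nondegenerate on the span of a, b, c, d.

    In a central product CD some factor, say D, has an element with nonzero
    e-coordinate; the commutators [e,-] are independent, which forces C to be
    central, and then C is contained in [CD,CD] = [D,D]. *)

From HB Require Import structures.
Require Import Defs.
From mathcomp Require Import all_boot all_algebra.
From mathcomp Require Import ring.
From mathcomp Require Import boolp classical_sets functions cardinality.

Set Implicit Arguments.
Unset Strict Implicit.
Unset Printing Implicit Defensive.

Import GRing.Theory.
Local Open Scope classical_set_scope.
Local Open Scope card_scope.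
Local Open Scope quotient_scope.
Local Open Scope group_scope.

(** * Commutators, derived subgroups and central products *)

Lemma commg_uniq (G : groupType) (x y z : G) : x * y = y * x * z -> [~ x, y] = z.
Proof. by rewrite commgC => /mulgI. Qed.

Lemma commg_mul_central (G : groupType) (x y u v : G) :
  center G u -> center G v -> [~ x * u, y * v] = [~ x, y].
Proof.
move=> Zu Zv; apply: commg_uniq.
have -> : x * u * (y * v) = x * y * (u * v).
  by rewrite -!mulgA; congr (_ * _); rewrite !mulgA Zu.
have -> : y * v * (x * u) = y * x * (u * v).
  rewrite -!mulgA; congr (_ * _); rewrite !mulgA Zv -!mulgA; congr (_ * _).
  by rewrite Zv.
rewrite (commgC x) -!(mulgA (y * x)); congr (_ * _); apply: commuteM.
  by rewrite /commute -Zu.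
by rewrite /commute -Zv.
Qed.

Lemma derived_commg (H : groupType) (x y : H) : derived H [~ x, y].
Proof. by apply: sub_generated; exists x => //; exists y. Qed.

Lemma derived_subgroup (H : groupType) : is_subgroup (derived H).
Proof. exact: generated_subgroup. Qed.

(** By this symmetry, indecomposability need only be argued for one of the two factors. *)
Lemma central_product_sym (H : groupType) (C D : set H) :
  central_product C D -> central_product D C.
Proof.
move=> [sC sD CD comm_CD].
have cdC c d : C c -> D d -> commute c d.
  move=> Cc Dd; apply/commgP/eqP.
  have : comm_subgroup C D [~ c, d]
    by apply: sub_generated; exists c => //; exists d.
  by rewrite comm_CD.
split=> //; apply/seteqP; split=> // x; last 1 first.
- by move=> ->; exact: (generated_subgroup _).1.
- move=> _; have : [set c * d | c in C & d in D] x by rewrite CD.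
  by move=> [c Cc [d Dd <-]]; exists d => //; exists c => //; apply/esym/cdC.
- apply; split; first by split=> [//|_ _ -> ->]; rewrite /= invg1 mulg1.
  by move=> _ [d Dd [c Cc <-]]; apply/eqP/commgP/esym/cdC.
Qed.

(** * Epicentral commutators *)

(** Conjugation by [k] multiplies [a] and [b] by central elements, which do not change their
    commutator. *)
Lemma central_commg_commute (K : groupType) (a b k : K) :
  center K [~ a, k] -> center K [~ b, k] -> commute [~ a, b] k.
Proof.
have conjE u : u ^ k = u * [~ u, k] by rewrite commgEl mulVKg.
by move=> Za Zb; apply/commgP;
  rewrite -conjg_fix conjRg !conjE commg_mul_central.
Qed.

(* The commutator of lifts of [a] and [b] to [K] is fixed by every element
   whose conjugation moves both lifts by central factors only. *)
Lemma not_capable (G : groupType) (a b c d : G) :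
  [~ a, b] = [~ c, d] -> [~ a, b] <> 1 ->
  (forall x, exists y y', [/\ x = y * y', commute a y, commute b y,
     commute c y' & commute d y']) ->
  ~ capable G.
Proof.
move=> eq_ab_cd ab_n1 dec [K [f bij_f]].
pose q (k : K) : quot (center_ns K) := \pi_(quot (center_ns K)) k.
have qM k k' : q (k * k') = q k * q k' by rewrite /q -quot_mulE.
have f1 : f 1 = 1 by apply: (mulgI (f 1)); rewrite -gmulfM !mulg1.
have q1 : q 1 = 1 by [].
have qP k k' : q k = q k' -> center K (k^-1 * k') by move/eqP/pi_quotP.
have qV k : q k^-1 = (q k)^-1.
  by apply: (mulgI (q k)); rewrite -qM !mulgV q1.
have fV x : f x^-1 = (f x)^-1.
  by apply: (mulgI (f x)); rewrite -gmulfM !mulgV f1.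
have qR k k' : q [~ k, k'] = [~ q k, q k'] by rewrite /commg /conjg !qM !qV.
have fR x y : f [~ x, y] = [~ f x, f y] by rewrite /commg /conjg !gmulfM !fV.
(* [l] lifts [G] to [K]; it is multiplicative only modulo the centre of [K]. *)
pose l x := repr (f x).
have ql x : q (l x) = f x by rewrite /q reprK.
have Zl x y : commute x y -> center K [~ l x, l y].
  move=> /commgP/eqP cxy; have := @qP 1 [~ l x, l y]; rewrite invg1 mul1g;
    apply.
  by rewrite qR !ql -fR cxy f1.
(* The lift of [[~ a, b]] agrees modulo the centre with the commutator of lifts of any pair having
   the same commutator, so this serves for both (a, b) and (c, d). *)
have tZ x y k : center K [~ l x, k] -> center K [~ l y, k] ->
    [~ x, y] = [~ a, b] -> commute (l [~ a, b]) k.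
  move=> Zx Zy xy_ab; have := @qP [~ l x, l y] (l [~ a, b]).
  rewrite qR !ql -fR xy_ab => /(_ erefl) Zt.
  rewrite -[l _](mulVKg [~ l x, l y]).
  apply/commute_sym/commuteM; apply/commute_sym;
    first exact: central_commg_commute.
  exact: Zt.
have Zt : center K (l [~ a, b]).
  move=> k; have [g _ fgK] := bij_f.
  have [y [y' [def_x ay by_ cy' dy']]] := dec (g (q k)).
  have: q (l y * l y') = q k by rewrite qM !ql -gmulfM -def_x fgK.
  move/qP => Zk; rewrite -[k](mulVKg (l y * l y')).
  apply: commuteM; last by apply/commute_sym.
  by apply: commuteM; [apply: (tZ a b) | apply: (tZ c d)] => //; apply: Zl.
have: q 1 = q (l [~ a, b]).
  by apply/eqP/pi_quotP; rewrite invg1 mul1g.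
by rewrite ql q1 -f1 => /(bij_inj bij_f) /esym.
Qed.

(** * Relations among commutators of a transversal *)

Section CentralZmod.
Variable G : groupType.

(** The centre is written additively, so that relations among central commutators become linear
    identities. *)
Definition central : Type := {z : G | `[< center G z >]}.
HB.instance Definition _ := SubChoice.on central.

Implicit Types u v w : central.

Lemma centralP u : center G (val u). Proof. exact/asboolP/(valP u). Qed.

Definition in_center (z : G) (Zz : center G z) : central :=
  exist _ z (introT (asboolP _) Zz).

Definition central0 := in_center (@center_subgroup G).1.
Definition centralN u := in_center (subgroupV (@center_subgroup G) (centralP u)).
Definition centralD u v :=
  in_center (subgroupM (@center_subgroup G) (centralP u) (centralP v)).

Lemma centralDA : associative centralD.
Proof. by move=> u v w; apply: val_inj; rewrite /= mulgA. Qed.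
Lemma centralDC : commutative centralD.
Proof. by move=> u v; apply: val_inj; exact: (centralP u). Qed.
Lemma central0D : left_id central0 centralD.
Proof. by move=> u; apply: val_inj; rewrite /= mul1g. Qed.
Lemma centralND : left_inverse central0 centralN centralD.
Proof. by move=> u; apply: val_inj; rewrite /= mulVg. Qed.

HB.instance Definition _ :=
  GRing.isZmodule.Build central centralDA centralDC central0D centralND.

Lemma val_centralMn u n : val (u *+ n)%R = val u ^+ n.
Proof. by elim: n => // n IHn; rewrite mulrS expgS -IHn. Qed.

Lemma val_central_sum (I : Type) (s : seq I) (P : pred I) (F : I -> central) :
  val (\sum_(i <- s | P i) F i)%R = \prod_(i <- s | P i) val (F i).
Proof. exact: (big_morph (val : central -> G)). Qed.

End CentralZmod.

(** Plücker relation m(a,b) m(c,d) = m(a,c) m(b,d) - m(a,d) m(b,c): the right side vanishes and the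
    left side is m(a,b)^2. *)
Lemma minors_eq0 (F : fieldType) (a a' b b' c c' d d' : F) :
  (a' * c - a * c' = 0)%R -> (a' * d - a * d' = 0)%R ->
  (a' * b - a * b' + -1 * (c' * d - c * d') = 0)%R -> (a' * b - a * b' = 0)%R.
Proof.
move=> ac ad /eqP; rewrite mulN1r subr_eq0 => /eqP ab_cd.
apply/eqP; rewrite -[_ == _]orbb -mulf_eq0 {2}ab_cd; apply/eqP.
transitivity ((a' * c - a * c') * (b' * d - b * d')
              + (a' * d - a * d') * (b * c' - b' * c))%R; first by ring.
by rewrite ac ad; ring.
Qed.

Section Relation.
Variables (p : nat) (p_pr : prime p) (G : groupType).
Hypothesis G_exp : forall x : G, x ^+ p = 1.
Hypothesis G_cl2 : forall x y : G, center G [~ x, y].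

Definition cbr (x y : G) : central G := in_center (G_cl2 x y).

Lemma cbrMl x y t : cbr (x * y) t = (cbr x t + cbr y t)%R.
Proof.
apply: val_inj; apply: commg_uniq => /=.
have := commgC x t; have := commgC y t; have := G_cl2 x t.
move: [~ x, t] [~ y, t] => u v Zu eq_y eq_x.
rewrite -mulgA eq_y (mulgA x) (mulgA x) eq_x -!mulgA; congr (_ * (_ * _)).
by rewrite !mulgA Zu.
Qed.

Lemma cbrC x y : cbr x y = (- cbr y x)%R.
Proof. by apply: val_inj; rewrite /= invgR. Qed.

Lemma cbr0 z t : center G z -> cbr z t = 0%R.
Proof. by move=> Zz; apply/val_inj/eqP/commgP. Qed.

Lemma cbrxx x : cbr x x = 0%R.
Proof. by apply: val_inj; rewrite /= commgg. Qed.

Lemma cbr1 t : cbr 1 t = 0%R.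
Proof. exact/cbr0/(@center_subgroup G).1. Qed.

Lemma cbrX x n t : cbr (x ^+ n) t = (cbr x t *+ n)%R.
Proof. by elim: n => [|n IHn]; rewrite ?cbr1 // expgS cbrMl IHn mulrS. Qed.

Lemma cbr_prod_transversal n (x : 'I_n -> G) (r : 'I_n -> nat) z t :
  center G z ->
  cbr ((\prod_(i < n) x i ^+ r i) * z) t = (\sum_(i < n) cbr (x i) t *+ r i)%R.
Proof.
move=> Zz; rewrite cbrMl (cbr0 _ Zz) addr0.
rewrite (big_morph (cbr^~ t) (fun a b => cbrMl a b t) (cbr1 t)).
by apply: eq_bigr => i _; rewrite cbrX.
Qed.

Lemma central_Mnp (u : central G) : (u *+ p = 0)%R.
Proof. by apply: val_inj; rewrite val_centralMn G_exp. Qed.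

Lemma central_Mnmod (u : central G) m : (u *+ (m %% p) = u *+ m)%R.
Proof.
by rewrite {2}(divn_eq m p) mulrnDr mulnC mulrnA central_Mnp mul0rn add0r.
Qed.

Lemma central_Mnpred (u : central G) : (u *+ p.-1 = - u)%R.
Proof.
apply/eqP; rewrite -subr_eq0 opprK -mulrSr prednK ?prime_gt0 //.
by rewrite central_Mnp.
Qed.

(* The minor [r_j s_i - r_i s_j], with [-1] replaced by [p - 1]. *)
Definition minor n (r s : 'I_n -> nat) (ij : 'I_n * 'I_n) : nat :=
  r ij.2 * s ij.1 + p.-1 * (r ij.1 * s ij.2).

(** Expand bi-additively over all pairs (i, j): the diagonal vanishes, pairs with j < i fold onto
    those with i < j by antisymmetry, and trivial commutators drop out. *)
Lemma cbr_minors n (x : 'I_n -> G) (r s : 'I_n -> nat) z z' :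
  center G z -> center G z' ->
  cbr ((\prod_(i < n) x i ^+ r i) * z) ((\prod_(i < n) x i ^+ s i) * z') =
  (\sum_(ij | comm_index x ij) cbr (x ij.2) (x ij.1) *+ minor r s ij)%R.
Proof.
move=> Zz Zz'; rewrite cbr_prod_transversal //.
under eq_bigr => i _ do rewrite cbrC cbr_prod_transversal // -sumrN -sumrMnl.
pose F (ij : 'I_n * 'I_n) := (cbr (x ij.1) (x ij.2) *+ (r ij.1 * s ij.2))%R.
transitivity (\sum_ij F ij)%R.
  rewrite -(pair_bigA _ (fun i j => F (i, j))) /=.
  apply: eq_bigr => i _; apply: eq_bigr => j _.
  by rewrite /F /= [cbr (x i) _]cbrC -mulNrn mulnC mulrnA.
rewrite (bigID (fun ij : 'I_n * 'I_n => ij.1 < ij.2)) /=.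
rewrite [X in (_ + X)%R](bigID (fun ij : 'I_n * 'I_n => ij.2 < ij.1)) /=.
rewrite [X in (_ + (_ + X))%R]big1 ?addr0; last first.
  move=> [i j] /=; rewrite -!leqNgt => /andP[ji ij].
  have -> : i = j by apply/val_inj/anti_leq; rewrite ij ji.
  by rewrite /F /= cbrxx mul0rn.
have swap_inj : injective (fun ij : 'I_n * 'I_n => (ij.2, ij.1)).
  by move=> [i j] [k l] [-> ->].
rewrite [X in (_ + X)%R](reindex_inj swap_inj) /=.
rewrite [X in (_ + X)%R]
  (eq_bigl (fun ij : 'I_n * 'I_n => ij.1 < ij.2)); last first.
  by move=> [i j] /=; rewrite -leqNgt andb_idl // => /ltnW.
rewrite -big_split /= /comm_index big_mkcondr; apply: eq_bigr => -[i j] _ /=.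
rewrite /F /minor /= mulrnDr [cbr (x i) (x j)]cbrC -central_Mnpred.
rewrite -mulrnA addrC.
by case: eqP => //= xij; rewrite (_ : cbr _ _ = 0%R) ?mul0rn ?addr0 //;
  apply: val_inj.
Qed.

(** Exponent [p] allows natural coefficients to be reduced modulo [p] to the range that
    [comm_relation] asks for. *)
Lemma comm_relation_intro n (x : 'I_n -> G) (c : 'I_n * 'I_n -> nat) ij :
  (\sum_(ij | comm_index x ij) cbr (x ij.2) (x ij.1) *+ c ij = 0)%R ->
  comm_index x ij -> ~~ (p %| c ij) -> comm_relation p x.
Proof.
move=> sum0 ij_edge p_c.
exists (fun ij => Ordinal (ltn_pmod (c ij) (prime_gt0 p_pr))).
split; last first.
  by exists ij.
have := congr1 val sum0; rewrite val_central_sum; apply: etrans.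
by apply: eq_bigr => kl _; rewrite -central_Mnmod val_centralMn.
Qed.

(* If the commutators of a transversal were independent, their coefficients
   in [~ a, b], [~ c, d], [~ a, c] and [~ a, d], which are 2x2 minors, would
   satisfy [m(a,b) = m(c,d)] and [m(a,c) = m(a,d) = 0]; these force
   [m(a,b) = 0]. *)
Lemma coinciding_commutators_relation (a b c d : G) :
  [~ a, b] = [~ c, d] -> [~ a, b] <> 1 -> commute a c -> commute a d ->
  forall n (x : 'I_n -> G), center_transversal p x -> comm_relation p x.
Proof.
move=> eq_ab_cd ab_n1 /commgP/eqP ac1 /commgP/eqP ad1 n x x_tr.
apply: contrapT => norel.
have indep (k : 'I_n * 'I_n -> nat) :
    (\sum_(ij | comm_index x ij) cbr (x ij.2) (x ij.1) *+ k ij = 0)%R ->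
    forall ij, comm_index x ij -> ((k ij)%:R = 0 :> 'F_p)%R.
  move=> sum0 ij ij_edge; apply/eqP; rewrite -(dvdn_pcharf (pchar_Fp p_pr)).
  by apply: contrapT => /negP nd; apply: norel; apply: comm_relation_intro nd.
have [ra [[za Za def_a] _]] := x_tr a; have [rb [[zb Zb def_b] _]] := x_tr b.
have [rc [[zc Zc def_c] _]] := x_tr c; have [rd [[zd Zd def_d] _]] := x_tr d.
pose coef (r : {ffun 'I_n -> 'I_p}) (i : 'I_n) : nat := r i.
have sum_ab := cbr_minors x (coef ra) (coef rb) Za Zb;
  rewrite -def_a -def_b in sum_ab.
have sum_cd := cbr_minors x (coef rc) (coef rd) Zc Zd;
  rewrite -def_c -def_d in sum_cd.
have sum_ac := cbr_minors x (coef ra) (coef rc) Za Zc;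
  rewrite -def_a -def_c in sum_ac.
have sum_ad := cbr_minors x (coef ra) (coef rd) Za Zd;
  rewrite -def_a -def_d in sum_ad.
have p1E : ((p.-1)%:R = -1 :> 'F_p)%R.
  apply/eqP; rewrite -subr_eq0 opprK natr1 prednK ?prime_gt0 //.
  by rewrite (pcharf0 (pchar_Fp p_pr)).
have minorE (r s : {ffun 'I_n -> 'I_p}) ij : ((minor (coef r) (coef s) ij)%:R =
    (coef r ij.2)%:R * (coef s ij.1)%:R - (coef r ij.1)%:R * (coef s ij.2)%:R
    :> 'F_p)%R.
  by rewrite natrD !natrM p1E mulN1r.
have ab0 ij : comm_index x ij -> ((minor (coef ra) (coef rb) ij)%:R = 0 :> 'F_p)%R.
  move=> ij_edge.
  have ac0 : ((minor (coef ra) (coef rc) ij)%:R = 0 :> 'F_p)%R.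
    by apply: indep => //; rewrite -sum_ac; apply: val_inj.
  have ad0 : ((minor (coef ra) (coef rd) ij)%:R = 0 :> 'F_p)%R.
    by apply: indep => //; rewrite -sum_ad; apply: val_inj.
  (* The factor [p.-1] plays the role of -1, since coefficients are natural numbers. *)
  have abcd : ((minor (coef ra) (coef rb) ij
                + p.-1 * minor (coef rc) (coef rd) ij)%:R = 0 :> 'F_p)%R.
    apply: (indep (fun ij => minor (coef ra) (coef rb) ij
                + p.-1 * minor (coef rc) (coef rd) ij)%N) => //.
    under eq_bigr => kl _ do rewrite mulrnDr mulnC mulrnA central_Mnpred.
    rewrite big_split /= sumrN -sum_ab -sum_cd.
    by apply/eqP; rewrite subr_eq0; apply/eqP/val_inj.
  move: ac0 ad0 abcd; rewrite natrD natrM p1E !minorE.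
  exact: minors_eq0.
apply: ab_n1; have := congr1 val sum_ab => /= ->.
rewrite big1 // => ij /ab0/eqP.
rewrite -(dvdn_pcharf (pchar_Fp p_pr)) => /dvdnP[k ->].
by rewrite mulrnA central_Mnp.
Qed.

End Relation.

(** * Central extensions by bi-additive cocycles *)

Record pairing (G : groupType) (S M : zmodType) := Pairing {
  pair_fun :> G * S -> G * S -> M;
  pairDl : forall x y t,
    pair_fun (x.1 * y.1, (x.2 + y.2)%R) t = (pair_fun x t + pair_fun y t)%R;
  pairDr : forall x y t,
    pair_fun t (x.1 * y.1, (x.2 + y.2)%R) = (pair_fun t x + pair_fun t y)%R
}.

Section PairingTheory.
Variables (G : groupType) (S M : zmodType) (b : pairing G S M).

Lemma pair1l t : b (1, 0%R) t = 0%R.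
Proof. by apply: (addrI (b (1, 0%R) t)); rewrite -pairDl /= mulg1 !addr0. Qed.

Lemma pair1r t : b t (1, 0%R) = 0%R.
Proof. by apply: (addrI (b t (1, 0%R))); rewrite -pairDr /= mulg1 !addr0. Qed.

Lemma pairNl x t : b (x.1^-1, (- x.2)%R) t = (- b x t)%R.
Proof.
by apply/eqP; rewrite -addr_eq0 -pairDl /= mulVg addNr pair1l.
Qed.

Lemma pairNr x t : b t (x.1^-1, (- x.2)%R) = (- b t x)%R.
Proof.
by apply/eqP; rewrite -addr_eq0 -pairDr /= mulVg addNr pair1r.
Qed.

(** A homomorphism to an abelian group kills commutators. *)
Lemma pairRr g h t : b t ([~ g, h], 0%R) = 0%R.
Proof.
have D u v : b t (u * v, 0%R) = (b t (u, 0%R) + b t (v, 0%R))%R.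
  by rewrite -pairDr /= addr0.
by apply: (addrI (b t (h * g, 0%R))); rewrite -D -commgC addr0 !D addrC.
Qed.

End PairingTheory.

(* The central extension of [G * S] by [M] with cocycle [b]. *)
Definition ext (G : groupType) (S M : zmodType) (b : pairing G S M) : Type :=
  (G * S * M)%type.

Section Extension.
Variables (G : groupType) (S M : zmodType) (b : pairing G S M).
Local Notation E := (ext b).
Implicit Types x y t : E.

HB.instance Definition _ := Choice.copy E (G * S * M)%type.

Definition ext_one : E := (1, 0%R, 0%R).
Definition ext_inv x : E := (x.1.1^-1, (- x.1.2)%R, (b x.1 x.1 - x.2)%R).
Definition ext_mul x y : E :=
  (x.1.1 * y.1.1, (x.1.2 + y.1.2)%R, (x.2 + y.2 + b x.1 y.1)%R).

Lemma ext_mulA : associative ext_mul.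
Proof.
move=> x y t; rewrite /ext_mul /= mulgA addrA pairDl pairDr; congr (_, _).
by rewrite !addrA !(addrAC _ (b y.1 t.1)) (addrAC _ t.2 (b x.1 y.1)).
Qed.

Lemma ext_mul1 : left_id ext_one ext_mul.
Proof. by case=> [[g s] m]; rewrite /ext_mul /= mul1g !add0r pair1l addr0. Qed.

Lemma ext_mulr1 : right_id ext_one ext_mul.
Proof. by case=> [[g s] m]; rewrite /ext_mul /= mulg1 !addr0 pair1r addr0. Qed.

Lemma ext_mulV : left_inverse ext_one ext_inv ext_mul.
Proof.
case=> [[g s] m]; rewrite /ext_mul /= mulVg addNr.
by rewrite (pairNl _ (g, s)) subrK subrr.
Qed.

Lemma ext_mulrV : right_inverse ext_one ext_inv ext_mul.
Proof.
case=> [[g s] m]; rewrite /ext_mul /= mulgV subrr.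
by rewrite (pairNr _ (g, s)) addrCA subrr addr0 subrr.
Qed.

HB.instance Definition _ := isGroup.Build E
  ext_mulA ext_mul1 ext_mulr1 ext_mulV ext_mulrV.

Lemma ext_mulE x y :
  x * y = (x.1.1 * y.1.1, (x.1.2 + y.1.2)%R, (x.2 + y.2 + b x.1 y.1)%R) :> E.
Proof. by []. Qed.

Lemma ext_commg x y :
  [~ x, y] = ([~ x.1.1, y.1.1], 0%R, (b x.1 y.1 - b y.1 x.1)%R) :> E.
Proof.
apply: commg_uniq; rewrite !ext_mulE /= pairRr addr0 -commgC addr0.
congr (_, _, _); first by rewrite addrC.
by rewrite addrACA subrr addr0 (addrC x.2) -!addrA addrC -!addrA;
  congr (_ + _)%R;
 rewrite addrC.
Qed.

Lemma ext_commuteP x y :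
  commute x y <-> commute x.1.1 y.1.1 /\ b x.1 y.1 = b y.1 x.1.
Proof.
split=> [/commgP/eqP | [/commgP/eqP c /eqP]].
  rewrite ext_commg => -[/eqP/commgP c /eqP]; rewrite subr_eq0 => /eqP.
  by split.
by rewrite -subr_eq0 => /eqP e; apply/commgP/eqP; rewrite ext_commg c e.
Qed.

(** The cocycle contributes 0 + 1 + ... + (n - 1) copies of its value at (x, x). *)
Lemma ext_expg x n : x ^+ n =
  (x.1.1 ^+ n, (x.1.2 *+ n)%R, (x.2 *+ n + b x.1 x.1 *+ 'C(n, 2))%R) :> E.
Proof.
elim: n => [|n IHn]; first by rewrite !expg0 !mulr0n addr0.
rewrite expgS IHn ext_mulE /= -expgS -mulrS; congr (_, _, _).
have -> : b x.1 (x.1.1 ^+ n, (x.1.2 *+ n)%R) = (b x.1 x.1 *+ n)%R.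
  elim: n {IHn} => [|n IHn]; first by rewrite expg0 mulr0n pair1r.
  by rewrite expgS mulrS (pairDr b x.1 (_, _)) IHn mulrS.
by rewrite binS bin1 mulrnDr !mulrS !addrA.
Qed.

End Extension.

(** * The abelianization as a vector space over F_p *)

Section Abelianization.
Variables (p : nat) (p_pr : prime p) (G : groupType).
Hypothesis G_exp : forall x : G, x ^+ p = 1.

Lemma val_FpD (a b : 'F_p) : val (a + b)%R = (val a + val b) %% p.
Proof. by rewrite /= [X in _ %% X](Fp_cast p_pr). Qed.

Lemma val_FpM (a b : 'F_p) : val (a * b)%R = (val a * val b) %% p.
Proof. by rewrite /= [X in _ %% X](Fp_cast p_pr). Qed.

Lemma central_scalerA (a b : 'F_p) (v : central G) :
  (v *+ b *+ a = v *+ val (a * b))%R.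
Proof. by rewrite val_FpM central_Mnmod // mulnC mulrnA. Qed.

Lemma central_scale1r (v : central G) : (v *+ val (1 : 'F_p))%R = v.
Proof. by rewrite /= modn_small ?mulr1n // Fp_cast ?prime_gt1. Qed.

Lemma central_scalerDr (a : 'F_p) (u v : central G) :
  ((u + v) *+ a = u *+ a + v *+ a)%R.
Proof. exact: mulrnDl. Qed.

Lemma central_scalerDl (v : central G) (a b : 'F_p) :
  (v *+ val (a + b) = v *+ a + v *+ b)%R.
Proof. by rewrite val_FpD central_Mnmod // mulrnDr. Qed.

Definition central_lmod : lmodType 'F_p := HB.pack (central G)
  (GRing.Zmodule_isLmodule.Build 'F_p (central G)
    central_scalerA central_scale1r central_scalerDr central_scalerDl).
End Abelianization.

(** The quotient by the derived subgroup is abelian, hence equal to its own centre, and exponent [p]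
    makes that additive group a vector space. *)
Lemma abelianization_lmod (p : nat) (G : groupType) : prime p ->
  (forall x : G, x ^+ p = 1) ->
  exists (V : lmodType 'F_p) (q : G -> V),
    [/\ forall g h, q (g * h) = (q g + q h)%R,
        forall v, exists g, q g = v
      & forall g, q g = 0%R <-> derived G g].
Proof.
move=> p_pr G_exp; pose Q := abelianization G.
pose pi (g : G) : Q := \pi_Q g.
have piM g h : pi (g * h) = pi g * pi h by rewrite /pi -quot_mulE.
have pi_surj (u : Q) : exists g, pi g = u by have [g ->] := quot_surj u;
  exists g.
have pi1 : pi 1 = 1 by [].
have pi_ker g : pi g = 1 <-> derived G g.
  have -> : pi g = 1 <-> pi 1 = pi g by rewrite pi1; split=> /esym.
  by split=> [/eqP/pi_quotP|Dg]; [|apply/eqP/pi_quotP]; rewrite invg1 mul1g.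
have Q_exp (u : Q) : u ^+ p = 1.
  have [g <-] := pi_surj u; have piX n : pi (g ^+ n) = pi g ^+ n.
    by elim: n => // n IHn; rewrite !expgS piM IHn.
  by rewrite -piX G_exp.
have Q_ab (u : Q) : center Q u.
  move=> v; have [g <-] := pi_surj u; have [h <-] := pi_surj v.
  have : pi [~ g, h] = 1 by apply/pi_ker; apply: sub_generated; exists g => //;
    exists h.
  by rewrite /commute -!piM commgC piM => ->; rewrite mulg1.
exists (central_lmod p_pr Q_exp), (fun g => in_center (Q_ab (pi g)) : central Q).
split=> [g h|v|g].
- by apply: val_inj; rewrite /= piM.
- by have [g e] := pi_surj (val (v : central Q)); exists g; apply: val_inj.
- by rewrite -pi_ker; split=> [/(congr1 val)|e]; [|apply: val_inj].
Qed.

(** * The overgroup *)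

Lemma add_pairE (U V : zmodType) (u u' : U) (v v' : V) :
  ((u, v) + (u', v') = (u + u', v + v') :> U * V)%R.
Proof. by []. Qed.

Lemma sub_pairE (U V : zmodType) (u u' : U) (v v' : V) :
  ((u, v) - (u', v') = (u - u', v - v') :> U * V)%R.
Proof. by []. Qed.

Section Construction.
Variables (p : nat) (p_pr : prime p) (p_odd : odd p) (G : groupType).
Hypothesis G_exp : forall x : G, x ^+ p = 1.
Hypothesis G_cl2 : forall x y : G, center G [~ x, y].
Variables (V : lmodType 'F_p) (q : G -> V).
Hypothesis qM : forall g h, q (g * h) = (q g + q h)%R.
Hypothesis q_surj : forall v, exists g, q g = v.
Hypothesis q_ker : forall g, q g = 0%R <-> derived G g.

Definition ka : 'I_6 := @Ordinal 6 0 isT.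
Definition kb : 'I_6 := @Ordinal 6 1 isT.
Definition kc : 'I_6 := @Ordinal 6 2 isT.
Definition kd : 'I_6 := @Ordinal 6 3 isT.
Definition ke : 'I_6 := @Ordinal 6 4 isT.
Definition kf : 'I_6 := @Ordinal 6 5 isT.

(* The independent commutators among the new generators; the 0-th one is both
   [a, b] and [c, d]. *)
Definition edge (k : 'I_6) : 'I_6 * 'I_6 :=
  nth (ka, kb)
    [:: (ka, kb); (ke, ka); (ke, kb); (kf, kc); (kf, kd); (ke, kf)] k.

(** A cocycle that is not alternating: commutators see [form s t - form t s]. In the test [k == ka],
    [ka] stands for edge 0, where the extra term makes [c, d] equal to [a, b]. *)
Definition form (s t : 'rV['F_p]_6) : 'rV['F_p]_6 :=
  \row_k (s ord0 (edge k).1 * t ord0 (edge k).2 +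
          if k == ka then s ord0 kc * t ord0 kd else 0)%R.

Lemma formDl s s' t : form (s + s')%R t = (form s t + form s' t)%R.
Proof. by apply/rowP=> k; rewrite !mxE; case: ifP => _; ring. Qed.

Lemma formDr s s' t : form t (s + s')%R = (form t s + form t s')%R.
Proof. by apply/rowP=> k; rewrite !mxE; case: ifP => _; ring. Qed.

Lemma form0l t : form 0%R t = 0%R.
Proof. by apply: (addrI (form 0%R t)); rewrite -formDl !addr0. Qed.

Lemma form0r t : form t 0%R = 0%R.
Proof. by apply: (addrI (form t 0%R)); rewrite -formDr !addr0. Qed.

(* The factor [V] records the commutators of [e] with [G]. *)
Definition new_cocycle (x y : G * 'rV['F_p]_6) : ('rV['F_p]_6 * V)%type :=
  (form x.2 y.2, (x.2 ord0 ke *: q y.1)%R).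

Lemma new_cocycleDl x y t : new_cocycle (x.1 * y.1, (x.2 + y.2)%R) t =
  (new_cocycle x t + new_cocycle y t)%R.
Proof. by rewrite /new_cocycle /= formDl mxE scalerDl. Qed.

Lemma new_cocycleDr x y t : new_cocycle t (x.1 * y.1, (x.2 + y.2)%R) =
  (new_cocycle t x + new_cocycle t y)%R.
Proof. by rewrite /new_cocycle /= formDr qM scalerDr. Qed.

Definition new_pairing : pairing G 'rV['F_p]_6 ('rV['F_p]_6 * V)%type :=
  Pairing new_cocycleDl new_cocycleDr.

Local Notation E := (ext new_pairing).
Implicit Types x y t : E.

Local Notation co x i := (x.1.2 ord0 i).

Lemma additive1 : q 1 = 0%R.
Proof. by apply: (addrI (q 1)); rewrite -qM mulg1 addr0. Qed.

Lemma derived_center (g : G) : derived G g -> center G g.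
Proof.
apply; split; first exact: center_subgroup.
by move=> _ [x _ [y _ <-]]; apply: G_cl2.
Qed.

Lemma overgroup_commuteP x y : commute x y <->
  [/\ commute x.1.1 y.1.1, form x.1.2 y.1.2 = form y.1.2 x.1.2
    & (co x ke *: q y.1.1 = co y ke *: q x.1.1)%R].
Proof.
rewrite ext_commuteP; split=> [[c [f s]] //|[c f s]].
by split=> //; rewrite /= /new_cocycle /= f s.
Qed.

(** Each coordinate of [form] other than the 0-th is a single product, so commuting elements have a
    vanishing 2x2 minor there; the 0-th mixes [a, b] with [c, d]. *)
Lemma commute_minor x y k : commute x y -> k != ka ->
  (co x (edge k).1 * co y (edge k).2 = co y (edge k).1 * co x (edge k).2)%R.
Proof.
move=> /overgroup_commuteP[_ /rowP/(_ k) + _] /negPf k0.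
by rewrite !mxE k0 !addr0.
Qed.

Definition new_gen (i : 'I_6) : E := (1, delta_mx ord0 i, 0%R).

Definition emb (g : G) : E := (g, 0%R, 0%R).

Lemma coord_gen i j : co (new_gen i) j = (j == i)%:R%R.
Proof. by rewrite mxE. Qed.

Lemma coordM x y i : co (x * y) i = (co x i + co y i)%R.
Proof. by rewrite mxE. Qed.

Lemma embM g h : emb (g * h) = emb g * emb h.
Proof. by rewrite ext_mulE /= /new_cocycle /= form0l mxE scale0r !addr0. Qed.

Lemma embV g : emb g^-1 = (emb g)^-1.
Proof. by apply: (mulgI (emb g)); rewrite -embM !mulgV. Qed.

(** These index the list in [edge], not the generators, although both range over 'I_6. *)
Definition edge_ea : 'I_6 := @Ordinal 6 1 isT.
Definition edge_eb : 'I_6 := @Ordinal 6 2 isT.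
Definition edge_fc : 'I_6 := @Ordinal 6 3 isT.
Definition edge_fd : 'I_6 := @Ordinal 6 4 isT.
Definition edge_ef : 'I_6 := @Ordinal 6 5 isT.

Lemma rV6_eq0 (s : 'rV['F_p]_6) : s ord0 ka = 0%R -> s ord0 kb = 0%R ->
  s ord0 kc = 0%R -> s ord0 kd = 0%R -> s ord0 ke = 0%R -> s ord0 kf = 0%R ->
  s = 0%R.
Proof.
move=> a b c d e f; apply/rowP=> -[k lt_k]; rewrite mxE.
case: k lt_k => [|[|[|[|[|[|//]]]]]] lt_k;
  [apply: etrans a|apply: etrans b|apply: etrans c|apply: etrans d
  |apply: etrans e|apply: etrans f]; congr (s _ _); exact: val_inj.
Qed.

(** * Centre, exponent and derived subgroup of the overgroup *)

(** Commuting with e kills the a-, b- and f-coordinates and the class of the [G]-component in [V];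
    commuting with f kills c and d; commuting with a kills e. Conversely, [G] has class at most
    2. *)
Lemma overgroup_centerP x : center E x <-> derived G x.1.1 /\ x.1.2 = 0%R.
Proof.
split=> [Zx | [Dx s0] y]; last first.
  apply/overgroup_commuteP; rewrite s0 form0l form0r mxE scale0r.
  by rewrite (q_ker _).2 // scaler0; split=> //; apply: derived_center.
have xe k (k0 : k != ka) := commute_minor (Zx (new_gen ke)) k0.
have xf k (k0 : k != ka) := commute_minor (Zx (new_gen kf)) k0.
have xa k (k0 : k != ka) := commute_minor (Zx (new_gen ka)) k0.
have xq := (overgroup_commuteP x (new_gen ke)).1 (Zx _).
have := xe edge_ea isT; rewrite /= !coord_gen /= mulr0 mul1r => /esym xa0.
have := xe edge_eb isT; rewrite /= !coord_gen /= mulr0 mul1r => /esym xb0.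
have := xe edge_ef isT; rewrite /= !coord_gen /= mulr0 mul1r => /esym xf0.
have := xf edge_fc isT; rewrite /= !coord_gen /= mulr0 mul1r => /esym xc0.
have := xf edge_fd isT; rewrite /= !coord_gen /= mulr0 mul1r => /esym xd0.
have := xa edge_ea isT; rewrite /= !coord_gen /= mulr1 mul0r => xe0.
split; last exact: rV6_eq0.
by have [_ _] := xq;
  rewrite coord_gen eqxx scale1r additive1 scaler0 => /esym/q_ker.
Qed.

Lemma overgroup_exp x : x ^+ p = 1.
Proof.
have Mn_p (W : lmodType 'F_p) (v : W) : (v *+ p = 0)%R.
  by rewrite -scaler_nat (pcharf0 (pchar_Fp p_pr)) scale0r.
rewrite ext_expg G_exp !Mn_p add0r.
(* Oddness of [p] gives 2 < p, so [p] divides this binomial coefficient. *)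
have /dvdnP[k ->] : p %| 'C(p, 2).
  by apply: prime_dvd_bin => //; rewrite /= odd_prime_gt2.
by rewrite mulrnA Mn_p.
Qed.

Lemma form_delta k a :
  (form (a *: delta_mx ord0 (edge k).1) (delta_mx ord0 (edge k).2)
   - form (delta_mx ord0 (edge k).2) (a *: delta_mx ord0 (edge k).1)
   = a *: delta_mx ord0 k)%R.
Proof.
apply/rowP=> l; rewrite !mxE.
by case: k => -[|[|[|[|[|[|//]]]]]] lt_k; case: l => -[|[|[|[|[|[|//]]]]]] lt_l;
  rewrite /= ?mulr1 ?mulr0 ?mul0r ?addr0 ?subr0 ?subrr.
Qed.

Lemma derived_emb (g : G) : derived G g -> derived E (emb g).
Proof.
have [E1 EV] := derived_subgroup E.
move=> Dg; apply: (Dg [set h | derived E (emb h)]); split.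
  split=> // h h' Dh Dh'; rewrite /= embM embV; exact: EV.
move=> _ [h _ [h' _ <-]] /=.
rewrite (_ : emb _ = [~ emb h, emb h']); first exact: derived_commg.
by rewrite /commg /conjg !embM !embV.
Qed.

Lemma ext_mul_central x m : x * ((1, 0%R, m) : E) = (x.1, (x.2 + m)%R).
Proof.
by rewrite ext_mulE (pair1r new_pairing) mulg1 !addr0; case: x => [[]].
Qed.

(** A central element is a product of three parts: one from the derived subgroup of [G], one spanned
    by the edge commutators, and one of the form [e, h] with [h] in [G]. *)
Lemma overgroup_center : center E = derived E.
Proof.
apply/seteqP; split=> x; last first.
  apply; split; first exact: center_subgroup.
  move=> _ [y _ [t _ <-]]; apply/overgroup_centerP; rewrite ext_commg /=;
    split=> //.
  exact: derived_commg.
have DM := subgroupM (derived_subgroup E).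
case: x => [[g s] [w v]] /overgroup_centerP /= [Dg ->].
have Dw : derived E (1, 0%R, (w, 0%R)).
  pose P (w : 'rV['F_p]_6) := derived E (1, 0%R, (w, 0%R)).
  have PD w1 w2 : P w1 -> P w2 -> P (w1 + w2)%R.
    move=> P1 P2; have := DM _ _ P1 P2.
    by rewrite ext_mul_central /= add_pairE addr0.
  change (P w); rewrite (row_sum_delta w).
  elim/big_ind: _ => [|w1 w2|k _]; [exact: (derived_subgroup E).1|exact: PD|].
  rewrite /P -form_delta.
  have := derived_commg ((1, (w ord0 k *: delta_mx ord0 (edge k).1)%R, 0%R) : E)
     (new_gen (edge k).2).
  rewrite ext_commg /= /new_cocycle /= additive1 !scaler0.
  by rewrite commgg sub_pairE subr0.
have [h qh] := q_surj v.
have Dv : derived E (1, 0%R, (0%R, v)).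
  have := derived_commg (new_gen ke) (emb h).
  rewrite ext_commg /= /new_cocycle /= form0l form0r !mxE /= comm1g.
  by rewrite scale1r additive1 scaler0 qh sub_pairE !subr0.
have := DM _ _ (DM _ _ (derived_emb Dg) Dw) Dv.
by rewrite !ext_mul_central /= add0r [(_ + _)%R]add_pairE addr0 add0r.
Qed.

(** * Indecomposability as a central product *)

Lemma central_factor_sub (C D : set E) (d : E) :
  central_product C D -> D d -> co d ke != 0%R -> C `<=` D.
Proof.
move=> [sC sD CD comm_CD] Dd d_e.
have cdC c' d' : C c' -> D d' -> commute c' d'.
  move=> Cc Dd'; apply/commgP/eqP.
  have : comm_subgroup C D [~ c', d']
    by apply: sub_generated; exists c' => //; exists d'.
  by rewrite comm_CD.
have split_gen x : exists c' d', [/\ C c', D d' & x = c' * d'].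
  have : [set c * d | c in C & d in D] x by rewrite CD.
  by move=> [c' Cc [d' Dd' <-]]; exists c', d'.
(* Write a = c1 d1. In the plane of e- and a-coordinates, c is parallel to d, c1 to d and d1 to c.
   If c and d both had nonzero e-coordinate, the projection (0, 1) of a would be a multiple of
   theirs, which is impossible. *)
have Ce0 c : C c -> co c ke = 0%R.
  move=> Cc; apply/eqP; apply: contrapT => /negP c_e.
  have [c1 [d1 [Cc1 Dd1 def_a]]] := split_gen (new_gen ka).
  have e_sum : (co c1 ke + co d1 ke = 0)%R by rewrite -coordM -def_a coord_gen.
  have a_sum : (co c1 ka + co d1 ka = 1)%R by rewrite -coordM -def_a coord_gen.
  have h0 := commute_minor (cdC _ _ Cc Dd) (isT : edge_ea != ka).
  have h1 := commute_minor (cdC _ _ Cc1 Dd) (isT : edge_ea != ka).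
  have h2 := commute_minor (cdC _ _ Cc Dd1) (isT : edge_ea != ka).
  rewrite /= in h0 h1 h2.
  have : (co d ke * co c ke == 0)%R.
    apply/eqP; rewrite -[LHS]mulr1 -a_sum.
    transitivity (co c ke * (co d ke * co c1 ka)
                  + co d ke * (co c ke * co d1 ka))%R; first by ring.
    rewrite -h1 h2.
    transitivity (co c ke * co c1 ke * co d ka + co d1 ke * (co d ke * co c ka))%R.
      by ring.
    rewrite -h0; transitivity (co c ke * co d ka * (co c1 ke + co d1 ke))%R.
      by ring.
    by rewrite e_sum mulr0.
  by rewrite mulf_eq0 (negPf d_e) (negPf c_e).
have minor0 c' d' k : C c' -> D d' -> k != ka -> co c' (edge k).1 = 0%R ->
    co d' (edge k).1 != 0%R -> co c' (edge k).2 = 0%R.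
  move=> Cc Dd' k0 c0 d0; have := commute_minor (cdC _ _ Cc Dd') k0.
  by rewrite c0 mul0r => /esym/eqP; rewrite mulf_eq0 (negPf d0) => /eqP.
have Cf0 c : C c -> co c kf = 0%R.
  by move=> Cc; apply: (@minor0 _ d edge_ef) => //; apply: Ce0.
(* Since [C] has no f-coordinate, that of the generator f comes from [D]; [d'] then kills the c- and
   d-coordinates of [C]. *)
have [d' Dd' d'_f] : exists2 d', D d' & co d' kf != 0%R.
  have [c1 [d1 [Cc1 Dd1 /(congr1 (fun x => co x kf))]]] :=
    split_gen (new_gen kf).
  rewrite coordM coord_gen Cf0 // add0r => e; exists d1 => //.
  by rewrite -e eqxx oner_neq0.
have CZ c : C c -> center E c.
  move=> Cc; apply/overgroup_centerP; split.
    have /overgroup_commuteP[_ _] := cdC _ _ Cc Dd.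
    rewrite Ce0 // scale0r => /esym/eqP; rewrite scaler_eq0 (negPf d_e) /=.
    by move/eqP/q_ker.
  apply: rV6_eq0; [| | | | exact: Ce0 | exact: Cf0].
  - by apply: (@minor0 _ d edge_ea) => //; apply: Ce0.
  - by apply: (@minor0 _ d edge_eb) => //; apply: Ce0.
  - by apply: (@minor0 _ d' edge_fc) => //; apply: Cf0.
  - by apply: (@minor0 _ d' edge_fd) => //; apply: Cf0.
(* With [C] central, every commutator of [E] is a commutator of elements of [D]. *)
move=> c /CZ; rewrite overgroup_center; apply; split=> // _ [x _ [y _ <-]].
have [c1 [d1 [Cc1 Dd1 ->]]] := split_gen x.
have [c2 [d2 [Cc2 Dd2 ->]]] := split_gen y.
rewrite (cdC _ _ Cc1 Dd1) (cdC _ _ Cc2 Dd2) commg_mul_central; [|exact: CZ..].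
rewrite /commg /conjg; do ![apply: subgroupM => //]; exact: subgroupV.
Qed.

Lemma overgroup_indecomposable (C D : set E) :
  central_product C D -> C `<=` D \/ D `<=` C.
Proof.
move=> CD_prod; have [sC sD CD _] := CD_prod.
have : [set c * d | c in C & d in D] (new_gen ke) by rewrite CD.
move=> [c Cc [d Dd /(congr1 (fun x => co x ke))]];
  rewrite coordM coord_gen eqxx => e1.
have [d0 | d_e] := eqVneq (co d ke) 0%R; last first.
  by left; apply: central_factor_sub d_e.
right; apply: (central_factor_sub (central_product_sym CD_prod) Cc).
by move: e1; rewrite d0 addr0 => ->; exact: oner_neq0.
Qed.

(** * The coinciding commutators: non-capability and relations *)

Lemma commg_gen k : [~ new_gen (edge k).1, new_gen (edge k).2] =
  (1, 0%R, (delta_mx ord0 k, 0%R)) :> E.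
Proof.
rewrite ext_commg /= /new_cocycle /= commgg additive1 !scaler0 sub_pairE subr0.
by have := form_delta k 1%R; rewrite !scale1r => ->.
Qed.

Lemma commg_cd : [~ new_gen kc, new_gen kd] = [~ new_gen ka, new_gen kb] :> E.
Proof.
rewrite (commg_gen ka) ext_commg /= /new_cocycle /=.
rewrite commgg additive1 !scaler0 sub_pairE subr0.
congr (_, (_, _)); apply/rowP=> l; rewrite !mxE.
by case: l => -[|[|[|[|[|[|//]]]]]] lt_l;
  rewrite /= ?mulr1 ?mulr0 ?mul0r ?addr0 ?subr0 ?subrr ?add0r.
Qed.

Lemma commg_ab_neq1 : [~ new_gen ka, new_gen kb] <> 1 :> E.
Proof.
rewrite (commg_gen ka) => /(congr1 (fun x : E => x.2.1 ord0 ka)).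
by rewrite /= !mxE !eqxx => /eqP; rewrite oner_eq0.
Qed.

Lemma overgroup_not_capable : ~ capable E.
Proof.
apply: (@not_capable _ (new_gen ka) (new_gen kb) (new_gen kc) (new_gen kd)).
- exact/esym/commg_cd.
- exact: commg_ab_neq1.
case=> [[g s] m].
(* [G], c, d and f commute with a and b, while a, b and e commute with c and d. The central part of
   the first factor is corrected by the cocycle of the product. *)
pose s1 : 'rV['F_p]_6 :=
  (\row_i if i \in [:: kc; kd; kf] then s ord0 i else 0)%R.
pose s2 : 'rV['F_p]_6 :=
  (\row_i if i \in [:: kc; kd; kf] then 0 else s ord0 i)%R.
exists (g, s1, (m - new_pairing (g, s1) (1%g, s2))%R), (1, s2, 0%R); split.
- rewrite ext_mulE /= mulg1 addr0 subrK; congr (_, _, _).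
  by apply/rowP=> i; rewrite !mxE; case: ifP; rewrite ?addr0 ?add0r.
all: apply/overgroup_commuteP; split; rewrite /= ?additive1 ?scaler0.
all: try exact/commute_sym/commute1.
all: try exact/commute1.
all: try by rewrite ?mxE ?scale0r.
all: apply/rowP=> -[k lt_k]; rewrite !mxE.
all: case: k lt_k => [|[|[|[|[|[|//]]]]]] lt_k;
  rewrite /= ?mulr1 ?mulr0 ?mul0r ?addr0 //.
Qed.

Lemma overgroup_relation n (x : 'I_n -> E) :
  center_transversal p x -> comm_relation p x.
Proof.
have gen_commute i j : form (delta_mx ord0 i) (delta_mx ord0 j) =
    form (delta_mx ord0 j) (delta_mx ord0 i) -> commute (new_gen i) (new_gen j).
  by move=> ij; apply/overgroup_commuteP; split;
    rewrite //= ?additive1 ?scaler0.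
apply: (@coinciding_commutators_relation p p_pr E overgroup_exp _
          (new_gen ka) (new_gen kb) (new_gen kc) (new_gen kd)).
- by move=> y t; rewrite overgroup_center; apply: derived_commg.
- exact/esym/commg_cd.
- exact: commg_ab_neq1.
all: apply: gen_commute; apply/rowP=> -[k lt_k]; rewrite !mxE.
all: case: k lt_k => [|[|[|[|[|[|//]]]]]] lt_k;
  rewrite /= ?mulr1 ?mulr0 ?mul0r ?addr0 //.
Qed.

(** * Embedding of [G] and membership in the class *)

Lemma emb_inj : injective emb.
Proof. by move=> g h []. Qed.

Lemma overgroup_contains : contains E G.
Proof.
pose f : {multiplicative G -> E} :=
  HB.pack emb (isMultiplicative.Build G E emb embM).
exists (range emb), f; split.
  split; first by exists 1.
  by move=> _ _ [g _ <-] [h _ <-]; exists (g / h) => //; rewrite embM embV.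
split=> [g _|g h _ _ /emb_inj //|x [g _ <-]]; first by exists g.
by exists g.
Qed.

Lemma overgroup_class_R : has_exponent G p -> class_R p E.
Proof.
move=> [p_gt0 _ p_min]; split.
- split=> [x|]; first by exists 1%N; rewrite expn1 overgroup_exp.
  split=> // [x|m m_gt0 Em]; first exact: overgroup_exp.
  (* Minimality of the exponent is inherited from the embedded copy of [G]. *)
  apply: p_min => // g; have embX n : emb (g ^+ n) = emb g ^+ n.
    by elim: n => // n IHn; rewrite !expgS embM IHn.
  by apply: emb_inj; rewrite embX Em.
- exact: overgroup_indecomposable.
- exact: overgroup_center.
- exact: overgroup_relation.
Qed.

(** * Rank of the abelianization *)

Lemma overgroup_generated (H : set E) : is_subgroup H -> derived E `<=` H ->
  range emb `<=` H -> (forall i, H (new_gen i)) -> forall x, H x.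
Proof.
move=> sH HD Hemb Hgen [[g s] m].
have HM := subgroupM sH.
have Hs : H (1, s, 0%R).
  pose P (s : 'rV['F_p]_6) := H (1, s, 0%R).
  (* Adding vectors produces a cocycle value, which is central, hence in the derived subgroup, and
     can be divided out. *)
  have PD s1 s2 : P s1 -> P s2 -> P (s1 + s2)%R.
    move=> P1 P2; set b := new_pairing (1%g, s1) (1%g, s2).
    have Hb : H (1, 0%R, (- b)%R).
      apply: HD; rewrite -overgroup_center; apply/overgroup_centerP.
      by split=> //; exact: (derived_subgroup G).1.
    have := HM _ _ (HM _ _ P1 P2) Hb.
    by rewrite ext_mul_central ext_mulE /= mulg1 !add0r subrr.
  change (P s); rewrite (row_sum_delta s).
  elim/big_ind: _ => [|s1 s2|i _]; [exact: sH.1|exact: PD|].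
  rewrite -[s ord0 i]natr_Zp scaler_nat.
  elim: (nat_of_ord _) => [|k IHk]; first exact: sH.1.
  by rewrite mulrS; apply: PD => //; apply: Hgen.
have Hm : H (1, 0%R, m).
  apply: HD; rewrite -overgroup_center; apply/overgroup_centerP.
  by split=> //; exact: (derived_subgroup G).1.
have Hg : H (emb g) by apply: Hemb; exists g.
have := HM _ _ (HM _ _ Hg Hs) Hm.
rewrite ext_mul_central ext_mulE /= mulg1 !add0r.
by rewrite /new_cocycle /= form0l mxE scale0r add0r.
Qed.

(** Lifts of generators of the abelianization of [G], together with the six new generators, generate
    that of [E]. A general [k] gives both bounds at once. *)
Lemma overgroup_rank k : 6 <= k ->
  rank_leD (abelianization E) (abelianization G) k.
Proof.
move=> k6 Y gen_Y.
pose pi (x : E) : abelianization E := \pi_(abelianization E) x.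
pose rho (g : G) : abelianization G := \pi_(abelianization G) g.
have piM x y : pi (x * y) = pi x * pi y by rewrite /pi -quot_mulE.
have piV x : pi x^-1 = (pi x)^-1 by rewrite /pi -quot_invE.
have pi_emb g h : rho g = rho h -> pi (emb g) = pi (emb h).
  move=> /eqP/pi_quotP /= Dgh; apply/eqP/pi_quotP => /=.
  have -> : (emb g)^-1 * emb h = emb (g^-1 * h); last exact: derived_emb.
  by apply: (mulgI (emb g)); rewrite mulVKg -embM mulVKg.
(* For an index of at least 6, [inord] returns its default 0, so the surplus points merely repeat
   a. *)
pose phi (u : abelianization G + 'I_k) : abelianization E :=
  match u with inl v => pi (emb (repr v)) | inr i => pi (new_gen (inord i)) end.
exists (phi @` ([set inl y | y in Y] `|` [set inr i | i in [set: 'I_k]])).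
split; last exact: card_image_le.
apply/seteqP; split=> // u _ H [sH XH].
have [x ->] := quot_surj u; rewrite -/(pi x).
apply: (@overgroup_generated [set x | H (pi x)]).
- by split=> [|y t Hy Ht] /=; [exact: sH.1 | rewrite piM piV; apply: sH.2].
- move=> y Dy /=; have -> : pi y = pi 1; last exact: sH.1.
  by apply/esym/eqP/pi_quotP; rewrite invg1 mul1g.
- move=> _ [g _ <-] /=.
  (* Quantifying over all representatives of [v] makes this set a subgroup to which minimality of
     [generated Y] applies. *)
  suff : [set v | forall g, rho g = v -> H (pi (emb g))] (rho g) by apply.
  have : generated Y (rho g) by rewrite gen_Y.
  apply; split; last first.
    move=> y Yy h hy; rewrite (@pi_emb h (repr y));
      last by rewrite hy /rho reprK.
    by apply: XH; exists (inl y) => //; left; exists y.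
  split=> [h h1|v w Hv Hw h hvw] /=.
    by rewrite (@pi_emb h 1) //; exact: sH.1.
  have [v' def_v] := quot_surj v; have [w' def_w] := quot_surj w.
  rewrite (@pi_emb h (v' / w')); last first.
    by rewrite hvw def_v def_w /rho -quot_mulE -quot_invE.
  rewrite embM embV piM piV.
  by apply: sH.2; [apply: Hv|apply: Hw]; rewrite ?def_v ?def_w.
- move=> i; apply: XH.
  exists (inr (widen_ord k6 i)); last by rewrite /= inord_val.
  by right; exists (widen_ord k6 i).
Qed.

End Construction.

(** * Embedding of [G] in a non-capable group of the class *)

Theorem theorem3p2 (p : nat) (G : groupType) (p_pr : prime p) (p_odd : odd p)
    (G_nt : nontrivial G) (G_cl2 : nil_class_le2 G) (G_exp : has_exponent G p) :
  (exists G2 : groupType, [/\ class_R p G2, ~ capable G2 & contains G2 G]) /\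
  (~ abelian G ->
     exists G2 : groupType, [/\ class_R p G2, ~ capable G2, contains G2 G
       & rank_leD (abelianization G2) (abelianization G) 6]) /\
  (abelian G ->
     exists G2 : groupType, [/\ class_R p G2, ~ capable G2, contains G2 G
       & rank_leD (abelianization G2) (abelianization G) 7]).
Proof.
have [_ G_p _] := G_exp.
have G_central (x y : G) : center G [~ x, y].
  move=> t; apply/commgP/eqP.
  have : comm_subgroup (derived G) [set: G] [~ [~ x, y], t].
    apply: sub_generated; exists [~ x, y]; first exact: derived_commg.
    by exists t.
  by rewrite G_cl2.
have [V [q [qM q_surj q_ker]]] := abelianization_lmod p_pr G_p.
have EC := overgroup_class_R p_pr p_odd G_p G_central qM q_surj q_ker G_exp.
have EN := @overgroup_not_capable _ _ _ _ qM.
have EG := overgroup_contains qM.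
have ER := overgroup_rank G_central qM q_surj q_ker.
split; first by exists (ext (new_pairing qM)).
by split=> _; exists (ext (new_pairing qM)); split=> //; apply: ER.
Qed.
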